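(* Let $\varSigma=(\mathbb{N},X,U,\mathcal{U},\phi)$ be a discrete-time control system. Let $Q$ be a controlled invariant set, let $\mathcal{C}=(\mathcal{A},\tau,\nu)$ be an invariant partition of $Q$, and let $\varphi,\psi\in C(U,\mathbb{R})$ with $\psi>0$. Then $$P_{inv,\psi}(\varphi,Q,\mathcal{C})=\inf\Big\{\beta\in\mathbb{R}:\ \limsup_{T\to\infty}R_{inv,\psi,T}(\varphi-\beta\psi,Q,\mathcal{C})<\infty\Big\},$$ where $P_{inv,\psi}(\varphi,Q,\mathcal{C})$ is the $\psi$-induced invariance pressure of $\varphi$ on $Q$ w.r.t. $\mathcal{C}$.
   Context: Control system. $\mathbb{N}=\{0,1,2,\dots\}$. $X$ is a metric space, $U$ is a compact metric space, $F:X\times U\to X$ is a map such that $F_u:=F(\cdot,u):X\to X$ is continuous for each fixed $u\in U$, and $\mathcal{U}$ is a subset of the set of all sequences $\omega=(\omega_k)_{k\in\mathbb{N}}$ in $U$. For a control sequence $\omega$ (infinite, or finite of length at least $k$) put $\phi(k,x,\omega)=F_{\omega_{k-1}}\circ\cdots\circ F_{\omega_0}(x)$, $\phi(0,x,\omega)=x$. The tuple $\varSigma=(\mathbb{N},X,U,\mathcal{U},\phi)$ is called a discrete-time control system. $C(U,\mathbb{R})$ is the set of continuous real functions on $U$. Controlled invariant set. A non-empty compact set $Q\subset X$ such that for every $x\in Q$ there is $\omega_x\in\mathcal{U}$ with $\phi(n,x,\omega_x)\in Q$ for all $n\in\mathbb{N}$. Invariant partition. A triple $\mathcal{C}=(\mathcal{A},\tau,\nu)$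 where $\mathcal{A}=\{A_1,\dots,A_q\}$ is a finite Borel partition of $Q$, $\tau\geq 1$ is an integer, and $\nu:\mathcal{A}\to U^\tau$ is a map such that $\phi(j,A_i,\nu(A_i))\subset Q$ for all $1\le i\le q$ and all integers $0\le j\le\tau$. Put $S=\{1,\dots,q\}$, $\omega_i:=\nu(A_i)$, and for a finite or infinite word $s=(s_0,s_1,\dots)$ over $S$ let $\omega_s=\omega_{s_0}\omega_{s_1}\cdots$ be the concatenation (of length $n\tau$ if $s$ has length $n$). For every $x\in Q$ there is a unique $\mathcal{C}(x)=(\mathcal{C}_j(x))_{j\in\mathbb{N}}\in S^{\mathbb{N}}$ with $\phi(j\tau,x,\omega_{\mathcal{C}(x)})\in A_{\mathcal{C}_j(x)}$ for every $j\in\mathbb{N}$. Write $\mathcal{C}_{[0,n)}(x)=(\mathcal{C}_0(x),\dots,\mathcal{C}_{n-1}(x))$; so $\omega_{\mathcal{C}_{[0,n)}(x)}\in U^{n\tau}$. For $\omega=(\omega_0,\dots,\omega_{n-1})\in U^n$ and $f\in C(U,\mathbb{R})$ put $S_nf(\omega)=\sum_{j=0}^{n-1}f(\omega_j)$. Separated sets. For $K\subset Q$ and $n\in\mathbb{N}$, a set $E\subset K$ is a $(\mathcal{C},n,K)$-separated set if $\mathcal{C}_{[0,n)}(x)\neq\mathcal{C}_{[0,n)}(y)$ for all distinct $x,y\in E$. Induced invariance pressure. For real $T>0$ and $n\in\mathbb{N}$ let $$X_n=X_n(T)=\{x\in Q: S_{n\tau}\psi(\omega_{\mathcal{C}_{[0,n)}(x)})\le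 T\tau \text{ and } S_{(n+1)\tau}\psi(\omega_{\mathcal{C}_{[0,n+1)}(x)})>T\tau\},$$ and let $S_T$ be the set of $n\in\mathbb{N}$ with $X_n\neq\emptyset$. Define $$P_{inv,\psi,T}(\varphi,Q,\mathcal{C})=\sup\Big\{\sum_{n\in S_T}\sum_{x\in F_n}e^{S_{n\tau}\varphi(\omega_{\mathcal{C}_{[0,n)}(x)})}: F_n\text{ is a }(\mathcal{C},n,X_n)\text{-separated set}\Big\},$$ $$P_{inv,\psi}(\varphi,Q,\mathcal{C})=\limsup_{T\to\infty}\frac{1}{T\tau}\log P_{inv,\psi,T}(\varphi,Q,\mathcal{C}).$$ The quantity $R$. For $T>0$ let $G_T$ be the set of $n\in\mathbb{N}$ such that there is $x\in Q$ with $S_{n\tau}\psi(\omega_{\mathcal{C}_{[0,n)}(x)})>T\tau$; for $n\in G_T$ let $Y_n=\{x\in Q: S_{n\tau}\psi(\omega_{\mathcal{C}_{[0,n)}(x)})>T\tau\}$. For $f\in C(U,\mathbb{R})$ define, with values in $[0,\infty]$, $$R_{inv,\psi,T}(f,Q,\mathcal{C})=\sup\Big\{\sum_{n\in G_T}\sum_{x\in F'_n}e^{S_{n\tau}f(\omega_{\mathcal{C}_{[0,n)}(x)})}: F'_n\text{ is a }(\mathcal{C},n,Y_n)\text{-separated set}\Big\}.$$ *)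

(* Defs.v *)
From HB Require Import structures.
From mathcomp Require Import all_boot all_order all_algebra.
From mathcomp Require Import all_classical all_reals all_analysis.

Set Implicit Arguments.
Unset Strict Implicit.
Unset Printing Implicit Defensive.

Import Order.TTheory GRing.Theory Num.Theory.
Import numFieldNormedType.Exports.

Local Open Scope classical_set_scope.
Local Open Scope ring_scope.

Record control_system (R : realType) (X U : metricType R) := ControlSystem {
  cs_map : X -> U -> X;
  cs_controls : set (nat -> U);
  cs_compact : compact [set: U];
  cs_continuous : forall u : U, continuous (fun x : X => cs_map x u)
}.

Section ControlSystems.
Context {R : realType} {X U : metricType R} (Sigma : control_system X U).

(* phi(k, x, w) for a finite control sequence w of length at least k. *)
Definition phi_fin (k : nat) (x : X) (w : seq U) : X :=
  foldl (cs_map Sigma) x (take k w).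

(* phi(k, x, w) for an infinite control sequence w. *)
Definition phi (k : nat) (x : X) (w : nat -> U) : X :=
  foldl (cs_map Sigma) x (mkseq w k).

Definition controlled_invariant (Q : set X) : Prop :=
  [/\ Q !=set0, compact Q &
      forall x, Q x -> exists2 w, cs_controls Sigma w & forall n, Q (phi n x w)].

(* The cells are A_1, ..., A_q with q = ip_pred.+1 (q > 0 because Q is
   non-empty), indexed by 'I_q.  As cells are non-empty and pairwise disjoint, a
   map defined on the set of cells is the same as a map defined on 'I_q. *)
Record invariant_partition (Q : set X) := InvariantPartition {
  ip_pred : nat;
  ip_cell : 'I_ip_pred.+1 -> set X;
  ip_tau : nat;
  ip_nu : 'I_ip_pred.+1 -> ip_tau.-tuple U;
  ip_tau_gt0 : (0 < ip_tau)%N;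
  ip_partition : partition [set: 'I_ip_pred.+1] ip_cell Q;
  ip_borel : forall i, <<s (@open X) >> (ip_cell i);
  ip_invariant : forall i j, (j <= ip_tau)%N ->
    [set phi_fin j x (ip_nu i) | x in ip_cell i] `<=` Q
}.

Arguments ip_cell {Q} _ _.
Arguments ip_nu {Q} _ _.
Arguments ip_tau_gt0 {Q} _.

(* S_n f (w) with n the length of w. *)
Definition birkhoff_sum (f : U -> R) (w : seq U) : R := \sum_(u <- w) f u.

Section Partition.
Context {Q : set X} (C : invariant_partition Q).

Local Notation tau := (ip_tau C).
Local Notation S := 'I_(ip_pred C).+1.

(* omega_s for a finite word s. *)
Definition control_of_word (s : seq S) : seq U :=
  flatten [seq tval (ip_nu C i) | i <- s].

(* omega_s for an infinite word s: its entry of index m is the entry of index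
   m mod tau of the block number m / tau. *)
Definition control_of_stream (s : nat -> S) : nat -> U := fun m =>
  tnth (ip_nu C (s (m %/ tau)%N)) (Ordinal (ltn_pmod m (ip_tau_gt0 C))).

Definition is_itinerary (x : X) (s : nat -> S) : Prop :=
  forall j, ip_cell C (s j) (phi (j * tau) x (control_of_stream s)).

(* C(x), for x in Q: see [itineraryP] and [itinerary_unique]; the constant
   sequence is a junk value for x outside of Q. *)
Definition itinerary (x : X) : nat -> S :=
  xget (fun=> ord0) [set s | is_itinerary x s].

(* C_[0,n)(x) *)
Definition itinerary_word (n : nat) (x : X) : seq S := mkseq (itinerary x) n.

(* S_(n tau) f (omega_(C_[0,n)(x))) *)
Definition itinerary_sum (f : U -> R) (n : nat) (x : X) : R :=
  birkhoff_sum f (control_of_word (itinerary_word n x)).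

Definition separated (n : nat) (K E : set X) : Prop :=
  E `<=` K /\
  forall x y, E x -> E y -> x <> y -> itinerary_word n x <> itinerary_word n y.

(* X_n(T) *)
Definition crossing_set (psi : U -> R) (T : R) (n : nat) : set X :=
  [set x | [/\ Q x, itinerary_sum psi n x <= T * tau%:R &
               T * tau%:R < itinerary_sum psi n.+1 x]].

(* S_T *)
Definition crossing_times (psi : U -> R) (T : R) : set nat :=
  [set n | crossing_set psi T n !=set0].

(* Y_n *)
Definition exceed_set (psi : U -> R) (T : R) (n : nat) : set X :=
  [set x | Q x /\ T * tau%:R < itinerary_sum psi n x].

(* G_T *)
Definition exceed_times (psi : U -> R) (T : R) : set nat :=
  [set n | exceed_set psi T n !=set0].

(* The supremum of sum_(n in N) sum_(x in E_n) e^(S_(n tau) f) over all families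
   of (C, n, K_n)-separated sets E_n, n in N. *)
Definition separated_sup (f : U -> R) (N : set nat) (K : nat -> set X) : \bar R :=
  ereal_sup [set \esum_(n in N) \esum_(x in E n) (expR (itinerary_sum f n x))%:E
            | E in [set E : nat -> set X |
                     forall n, N n -> separated n (K n) (E n)]].

Definition invariance_pressure_at (psi f : U -> R) (T : R) : \bar R :=
  separated_sup f (crossing_times psi T) (crossing_set psi T).

Definition invariance_pressure (psi f : U -> R) : \bar R :=
  limf_esup (fun T : R =>
    ((T * tau%:R)^-1%:E * lne (invariance_pressure_at psi f T))%E) (pinfty_nbhs R).

Definition R_inv (psi f : U -> R) (T : R) : \bar R :=
  separated_sup f (exceed_times psi T) (exceed_set psi T).

Lemma control_of_word_mkseqS s j :
  control_of_word (mkseq s j.+1) =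
  control_of_word (mkseq s j) ++ ip_nu C (s j).
Proof.
by rewrite mkseqS /control_of_word map_rcons -cats1 flatten_cat /= cats0.
Qed.

Lemma mkseq_control_of_stream s j :
  mkseq (control_of_stream s) (j * tau) = control_of_word (mkseq s j).
Proof.
elim: j => [|j IHj]; first by rewrite mul0n.
rewrite mulSnr /mkseq iotaD map_cat add0n -/(mkseq _ _) IHj.
rewrite control_of_word_mkseqS; congr (_ ++ _); apply: (@eq_from_nth _ (control_of_stream s 0)) => [|i].
  by rewrite size_map size_iota size_tuple.
rewrite size_map size_iota => ltit.
rewrite (nth_map 0%N) ?size_iota// nth_iota// /control_of_stream.
have e : ((j * tau + i) %/ tau = j)%N.
  by rewrite divnMDl ?ip_tau_gt0// divn_small// addn0.
rewrite e (tnth_nth (control_of_stream s 0)) /=.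
by rewrite modnMDl modn_small.
Qed.

Lemma phi_control_of_stream s j x :
  phi (j * tau) x (control_of_stream s) =
  foldl (cs_map Sigma) x (control_of_word (mkseq s j)).
Proof. by rewrite /phi mkseq_control_of_stream. Qed.

Lemma itinerary_exists x : Q x -> exists s, is_itinerary x s.
Proof.
move=> Qx.
have [cov _ _] := ip_partition C.
have cellP y : exists i, Q y -> ip_cell C i y.
  have [Qy|nQy] := pselect (Q y); last by exists ord0.
  by move: Qy; rewrite -{1}cov => -[i _ yi]; exists i.
have [c cP] := choice cellP.
pose step y := foldl (cs_map Sigma) y (ip_nu C (c y)).
have Qstep y : Q y -> Q (step y).
  move=> /cP yc; apply: (@ip_invariant _ C (c y) tau) => //.
  by exists y => //; rewrite /phi_fin take_oversize ?size_tuple.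
have Qiter j : Q (iter j step x) by elim: j => //= j; exact: Qstep.
exists (fun j => c (iter j step x)) => j; rewrite phi_control_of_stream.
set s := (fun j => _); suff -> : foldl (cs_map Sigma) x (control_of_word (mkseq s j)) =
  iter j step x by exact/cP/Qiter.
by elim: j => // j IHj; rewrite control_of_word_mkseqS foldl_cat IHj.
Qed.

Lemma is_itinerary_inj x s t : is_itinerary x s -> is_itinerary x t -> s = t.
Proof.
move=> sx tx; apply/funext => j.
have [_ /trivIsetP triv _] := ip_partition C.
elim/ltn_ind: j => j IHj; apply: contrapT => /eqP st.
have := sx j; have := tx j; rewrite !phi_control_of_stream.
have -> : mkseq t j = mkseq s j.
  by apply/eq_in_map => i; rewrite mem_iota => /= /IHj.
move=> ty sy; have := triv _ _ I I st; rewrite -subset0.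
by apply; split; [exact: sy|exact: ty].
Qed.

Lemma itineraryP x : Q x -> is_itinerary x (itinerary x).
Proof. by move=> /itinerary_exists[s sx]; exact: (xgetI _ sx). Qed.

Lemma itinerary_unique x s : Q x -> is_itinerary x s -> s = itinerary x.
Proof. by move=> /itineraryP xP sx; exact: is_itinerary_inj sx xP. Qed.

End Partition.
End ControlSystems.

(* Main.v *)
(** Write [p n x] for the psi-sum along the first [n] blocks of the itinerary of
    [x], [t] for [T * tau], and [phi] for varphi.  As there are finitely many
    cells and psi > 0, one block increases [p] by an amount between two constants
    [m > 0] and [M].
    A point crossing the level [t] at time [n] has [t - M < p n x <= t], so the
    crossing sum of [exp phi] at level [t] is at most a constant times
    [exp (beta * t)] times the sum of [exp (phi - beta * psi)] beyond level
    [t - M]: if the latter stays bounded, the pressure is at most [beta].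
    Conversely, the points beyond level [t] split into the slabs
    [t + k * m < p n x <= t + (k + 1) * m], and the points of the k-th slab all
    cross the level [t + (k + 1) * m] at time [n].  If the pressure is less than
    [c < beta], the k-th slab contributes at most a constant times
    [exp (- (beta - c) * (t + (k + 1) * m))], which is summable in [k] with a sum
    bounded in [t]. *)

Require Import Defs.
From mathcomp Require Import all_boot all_order all_algebra.
From mathcomp Require Import all_classical all_reals all_analysis.
From mathcomp Require Import lra.
Import Order.TTheory GRing.Theory Num.Theory.
Import numFieldNormedType.Exports.
Local Open Scope classical_set_scope.
Local Open Scope ring_scope.

(** * Limits superior and non-negative sums in the extended reals *)

Section ExtendedReals.
Context {R : realType}.
Local Open Scope ereal_scope.

Lemma limf_esup_lt_near {T : choiceType} {X : filteredType T} (f : X -> \bar R)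
    (F : set_system X) (y : \bar R) :
  Filter F -> limf_esup f F < y -> \forall x \near F, f x <= y.
Proof.
move=> FF /ereal_inf_lt[_ [V FV <-] /ltW Vy].
by apply: filterS FV => x Vx; apply: le_trans Vy; apply: ereal_sup_ubound; exists x.
Qed.

Lemma limf_esup_le_near {T : choiceType} {X : filteredType T} (f : X -> \bar R)
    (F : set_system X) (y : \bar R) :
  (\forall x \near F, f x <= y) -> limf_esup f F <= y.
Proof.
move=> Fy; apply: (@le_trans _ _ (ereal_sup (f @` [set x | f x <= y]))).
  by apply: ereal_inf_lbound; exists [set x | f x <= y].
by apply: ge_ereal_sup => _ [x ? <-].
Qed.

Lemma lne_le_ln (x : \bar R) (r : R) : (0 < r)%R -> 0 <= x -> x <= r%:E ->
  lne x <= (ln r)%:E.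
Proof.
move=> r0 x0 xr; rewrite -lne_EFin// lee_lne// in_itv/= leey andbT//.
by rewrite lee_fin ltW.
Qed.

Lemma esum_subset_support {T : choiceType} (I J : set T) (a : T -> \bar R) :
  (forall i, J i -> 0 <= a i) -> (forall i, I i -> ~ J i -> a i = 0) ->
  \esum_(i in I) a i <= \esum_(i in J) a i.
Proof.
move=> J0 a0; rewrite esum_mkcond [leRHS]esum_mkcond; apply: le_esum => i _.
case: ifPn => [/set_mem Ii|_]; case: ifPn => [/set_mem Ji|/negP nJ] //.
- by rewrite a0// => Ji; apply: nJ; exact/mem_set.
- exact: J0.
Qed.

Lemma esumZl_le {T : choiceType} (I : set T) (a : T -> \bar R) (c : R) :
  (0 <= c)%R -> (forall i, 0 <= a i) ->
  \esum_(i in I) (c%:E * a i) <= c%:E * \esum_(i in I) a i.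
Proof.
move=> c0 a0; apply: ge_ereal_sup => _ [A [finA AI] <-].
rewrite -ge0_mule_fsumr//; apply: lee_wpmul2l; first by rewrite lee_fin.
by apply: esum_ge; exists A.
Qed.

Lemma geometric_nneseries_le (a z : R) : (0 <= a)%R -> (0 < z < 1)%R ->
  \sum_(k <oo) (a * z ^+ k)%:E <= (a / (1 - z))%:E.
Proof.
move=> a0 /andP[z0 z1].
have az0 k : (0 <= a * z ^+ k)%R by rewrite mulr_ge0// exprn_ge0// ltW.
apply: lime_le; first by apply: is_cvg_nneseries => k _ _; rewrite lee_fin.
apply: nearW => n; rewrite sumEFin lee_fin.
have := @geometric_le_lim R n a z a0 z0; rewrite ger0_norm ?(ltW z0)//.
by move=> /(_ z1); rewrite seriesEnat.
Qed.

(** The strict gap [c < b] costs nothing in the limit, and it is what later makes the slab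
    contributions decay geometrically. *)
Lemma le_of_lt_EFin (x y : \bar R) :
  (forall c b : R, (c < b)%R -> x < c%:E -> y <= b%:E) -> y <= x.
Proof.
case: x => [r| |] xy; first 1 last.
- by rewrite leey.
- case: y xy => [s| |] // xy; last by have := xy _ _ (ltrN10 R) (ltNyr _).
  have s12 : (s - 2 < s - 1)%R by lra.
  by have := xy _ _ s12 (ltNyr _); rewrite lee_fin lerBrDr gerDl ler10.
- apply/lee_addgt0Pr => e e0; rewrite -EFinD.
  by apply: (xy (r + e / 2)%R); rewrite ?lte_fin; lra.
Qed.

Lemma lty_EFin_gt0 (x : \bar R) : x < +oo -> exists2 K : R, (0 < K)%R & x < K%:E.
Proof.
case: x => [r| |]// _; last by exists 1%R; rewrite ?ltNyr.
by exists (`|r| + 1)%R; rewrite ?ltr_wpDl// lte_fin (le_lt_trans (ler_norm r))// ltrDl.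
Qed.

End ExtendedReals.

(** Bounds, for [b] of either sign, the error made when [b * p] is replaced by [b] times a level at
    distance at most [m] from [p]. *)
Lemma ler_mul_norm {R : realDomainType} (b d m : R) : 0 <= d <= m ->
  b * d <= `|b| * m.
Proof.
move=> /andP[d0 dm]; apply: (@le_trans _ _ (`|b| * d)).
  by rewrite ler_wpM2r// ler_norm.
by rewrite ler_wpM2l.
Qed.

Lemma slab_exists {R : realType} (t m p : R) : 0 < m -> t < p ->
  exists k : nat, t + k%:R * m < p <= t + k.+1%:R * m.
Proof.
move=> m0 tp.
have y0 : 0 < (p - t) / m by rewrite divr_gt0// subr_gt0.
have := real_ceil_itv (num_real ((p - t) / m)).
(* The ceiling is a positive integer [k.+1]; this [k] is the index of the slab. *)
have : 0 < Num.ceil ((p - t) / m) by rewrite real_ceil_gt_int ?num_real.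
case: (Num.ceil _) => [[|k]|k] // _ /andP[]; rewrite ltr_pdivlMr// ler_pdivrMr//.
rewrite intrB intS intrD -pmulrn => lo hi.
exists k; rewrite -natr1; lra.
Qed.

(** * Growth of the sums along itineraries, block by block *)

Section Sums.
Context {R : realType} {X U : metricType R} {Sigma : control_system X U}.
Context {Q : set X} (C : invariant_partition Sigma Q).
Local Notation tau := (ip_tau C).

Lemma itinerary_sumS (f : U -> R) n x :
  itinerary_sum C f n.+1 x =
  itinerary_sum C f n x + birkhoff_sum f (ip_nu (itinerary C x n)).
Proof.
by rewrite /itinerary_sum /itinerary_word control_of_word_mkseqS /birkhoff_sum big_cat.
Qed.

Lemma itinerary_sumBZ (f g : U -> R) (b : R) n x :
  itinerary_sum C (fun u => f u - b * g u) n x =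
  itinerary_sum C f n x - b * itinerary_sum C g n x.
Proof. by rewrite /itinerary_sum /birkhoff_sum sumrB mulr_sumr. Qed.

Lemma birkhoff_cell_gt0 (psi : U -> R) (i : 'I_(ip_pred C).+1) :
  (forall u, 0 < psi u) -> 0 < birkhoff_sum psi (ip_nu i).
Proof.
move=> psi0; rewrite /birkhoff_sum; have := ip_tau_gt0 C.
case: (ip_nu i) => -[|u s] /= /eqP <- // _.
by rewrite big_cons ltr_pwDl// sumr_ge0// => v _; exact: ltW.
Qed.

Lemma itinerary_sum_increment (psi : U -> R) : (forall u, 0 < psi u) ->
  exists m M, 0 < m /\ forall n x,
    itinerary_sum C psi n x + m <= itinerary_sum C psi n.+1 x <=
    itinerary_sum C psi n x + M.
Proof.
move=> psi0; pose p (i : 'I_(ip_pred C).+1) := birkhoff_sum psi (ip_nu i).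
have p0 i : 0 < p i by exact: birkhoff_cell_gt0.
(* Capping the minimum at 1 keeps it positive; the total over all cells bounds each block, since all
   terms are positive. *)
exists (\big[Num.min/1]_i p i), (\sum_i p i); split.
- exact: lt_bigmin.
- move=> n x; rewrite itinerary_sumS !lerD2l bigmin_le//=.
  rewrite (bigD1 (itinerary C x n))//= lerDl sumr_ge0// => i _; exact: ltW.
Qed.

(** * Comparison and subadditivity of suprema over separated families *)

Section SeparatedSup.
Local Open Scope ereal_scope.

Lemma empty_separated n (K : set X) : Defs.separated C n K set0.
Proof. by split. Qed.

Lemma separated_sup_ge0 f N (K : nat -> set X) : 0 <= separated_sup C f N K.
Proof.
apply: (@le_trans _ _ (\esum_(n in N) \esum_(x in (set0 : set X))
    (expR (itinerary_sum C f n x))%:E)).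
  by apply: esum_ge0 => n _; apply: esum_ge0 => x _; rewrite lee_fin expR_ge0.
by apply: ereal_sup_ubound; exists (fun=> set0) => // n _; exact: empty_separated.
Qed.

Lemma separated_sub n (K K' E : set X) : K `<=` K' ->
  Defs.separated C n K E -> Defs.separated C n K' E.
Proof. by move=> KK' [EK sepE]; split=> //; exact: subset_trans KK'. Qed.

Lemma le_separated_sup (f g : U -> R) N N' (K K' : nat -> set X) (c : R) :
  (0 <= c)%R -> N `<=` N' -> (forall n, K n `<=` K' n) ->
  (forall n x, K n x -> (expR (itinerary_sum C f n x) <=
                         c * expR (itinerary_sum C g n x))%R) ->
  separated_sup C f N K <= c%:E * separated_sup C g N' K'.
Proof.
move=> c0 NN' KK' fg; apply: ge_ereal_sup => _ [E sepE <-].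
have g0 n x : 0 <= (expR (itinerary_sum C g n x))%:E by rewrite lee_fin expR_ge0.
have sg0 n (A : set X) : 0 <= \esum_(x in A) (expR (itinerary_sum C g n x))%:E.
  by apply: esum_ge0.
(* [E n] is unconstrained for [n] outside [N], so it is emptied there to be admissible for [N']. *)
pose E' n := if n \in N then E n else set0.
apply: (@le_trans _ _ (\esum_(n in N)
    (c%:E * \esum_(x in E' n) (expR (itinerary_sum C g n x))%:E))).
  apply: le_esum => n Nn; apply: le_trans (esumZl_le _ _ _ c0 _) => //.
  rewrite /E' mem_set//; apply: le_esum => x Ex.
  by rewrite -EFinM lee_fin fg//; have [EK _] := sepE _ Nn; exact: EK.
apply: le_trans (esumZl_le _ _ _ c0 _) _ => //.
apply: lee_wpmul2l; first by rewrite lee_fin.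
apply: (@le_trans _ _ (\esum_(n in N') \esum_(x in E' n)
    (expR (itinerary_sum C g n x))%:E)).
  by apply: esum_subset_support => // n Nn /(_ (NN' _ Nn)).
apply: ereal_sup_ubound; exists E' => // n N'n; rewrite /E'.
case: ifPn => [/set_mem Nn|_]; last exact: empty_separated.
exact: separated_sub _ _ _ _ (KK' n) (sepE _ Nn).
Qed.

(** Subsets of separated sets are separated. Hence giving each pair [(n, x)] one index [k] splits
    any family for [K] into admissible families for the [K_ k], and non-negative sums may be
    regrouped. *)
Lemma separated_sup_bigcup (f : U -> R) N K (N_ : nat -> set nat)
    (K_ : nat -> nat -> set X) :
  (forall n x, K n x -> exists k, K_ k n x) ->
  (forall k n, K_ k n !=set0 -> N_ k n) ->
  separated_sup C f N K <= \sum_(k <oo) separated_sup C f (N_ k) (K_ k).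
Proof.
move=> KK_ KN_; apply: ge_ereal_sup => _ [E sepE <-].
pose a n x := (expR (itinerary_sum C f n x))%:E.
have a0 n x : 0 <= a n x by rewrite lee_fin expR_ge0.
have /choice[kappa kappaP] : forall z : nat * X, exists k,
    K z.1 z.2 -> K_ k z.1 z.2.
  move=> [n x]; have [Kx|nKx] := pselect (K n x); last by exists 0%N.
  by have [k Kk] := KK_ _ _ Kx; exists k.
pose E_ k n := E n `&` [set x | kappa (n, x) = k].
(* The double sum becomes one sum over pairs, so that the disjoint pieces indexed by [k] can be
   separated. *)
rewrite esum_esum//.
have -> : N `*`` E = \bigcup_k (N `*`` E_ k).
  apply/seteqP; split=> [[n x] [/= Nn Ex]|[n x] [k _ [/= Nn [Ex _]]]] //.
  by exists (kappa (n, x)).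
rewrite nneseries_sum_bigcup//; last first.
  apply/trivIsetP => i j _ _ ij; rewrite -subset0 => -[n x] /=.
  by move=> [[_ [_ /= ki]] [_ [_ /= kj]]]; move: ij; rewrite -ki -kj eqxx.
apply: lee_nneseries => k _; first by move=> _; exact: esum_ge0.
rewrite -(@esum_esum _ _ _ N (E_ k) a)//.
have E_K n : N n -> E_ k n `<=` K_ k n.
  by move=> Nn x [Ex <-]; apply: kappaP; have [EK _] := sepE _ Nn; exact: EK.
pose E' n := if n \in N then E_ k n else set0.
apply: (@le_trans _ _ (\esum_(n in N_ k) \esum_(x in E' n) a n x)).
  rewrite (eq_esum (b := fun n => \esum_(x in E' n) a n x)); last first.
    by move=> n Nn; rewrite /E' mem_set.
  (* At times outside [N_ k] the set [K_ k n] is empty, so the inner sum vanishes. *)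
  apply: esum_subset_support => [n _|n Nn nNk]; first exact: esum_ge0.
  apply: esum1 => x; rewrite /E' mem_set// => /(E_K _ Nn) Kx.
  by exfalso; apply/nNk/KN_; exists x.
apply: ereal_sup_ubound; exists E' => // n _; rewrite /E'.
case: ifPn => [/set_mem Nn|_]; last exact: empty_separated.
split; first exact: E_K.
by have [_ sepEn] := sepE _ Nn => x y [Ex _] [Ey _]; exact: sepEn.
Qed.

End SeparatedSup.

(** * Comparison of the pressure with the tilted sums *)

Section Pressure.
Context (varphi psi : U -> R).
Local Notation tilted b := (fun u => varphi u - b * psi u).

Let tau0 : 0 < tau%:R :> R.
Proof. by rewrite ltr0n; exact: ip_tau_gt0. Qed.

Lemma invariance_pressure_at_le (b M T : R) :
  (forall n x, itinerary_sum C psi n.+1 x <= itinerary_sum C psi n x + M) ->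
  (invariance_pressure_at C psi varphi T <=
   (expR (b * (T * tau%:R) + `|b| * M))%:E *
   R_inv C psi (tilted b) (T - M / tau%:R))%E.
Proof.
move=> incM.
have shift : (T - M / tau%:R) * tau%:R = T * tau%:R - M.
  by rewrite mulrBl divfK ?gt_eqF.
have KK n : crossing_set C psi T n `<=` exceed_set C psi (T - M / tau%:R) n.
  move=> x [Qx lo hi]; split => //; rewrite shift ltrBlDr.
  exact: lt_le_trans (incM n x).
apply: le_separated_sup => //; first by move=> n [x /KK Yx]; exists x.
move=> n x [Qx lo hi]; rewrite -expRD ler_expR itinerary_sumBZ.
set p := itinerary_sum C psi n x in lo *.
(* With [t = T * tau], write [b * p = b * t + (- b) * (t - p)], where [t - p] lies between 0 and
   [M]. *)
have := @ler_mul_norm _ (- b) (T * tau%:R - p) M; rewrite normrN.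
have -> : 0 <= T * tau%:R - p <= M by have := incM n x; rewrite -/p; lra.
by move=> /(_ isT); lra.
Qed.

Lemma R_inv_le (b c m T0 : R) : 0 < m -> c < b ->
  (forall n x, itinerary_sum C psi n x + m <= itinerary_sum C psi n.+1 x) ->
  (forall T, T0 < T ->
    (invariance_pressure_at C psi varphi T <= (expR (c * (T * tau%:R)))%:E)%E) ->
  exists K, forall T, 0 <= T -> T0 < T -> (R_inv C psi (tilted b) T <= K%:E)%E.
Proof.
(* [a * z ^+ k] will dominate the k-th slab: [z] is the decay over one slab of width [m], [a] the
   cost of replacing [p] by the top level of the slab. *)
move=> m0 cb incm Pc; pose z := expR (- (b - c) * m); pose a := expR (`|b| * m).
exists (a / (1 - z)) => T T_ge0 T0T; set t := T * tau%:R.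
have t0 : 0 <= t by rewrite mulr_ge0// ltW.
pose K_ k n := [set x | Q x /\
  t + k%:R * m < itinerary_sum C psi n x <= t + k.+1%:R * m].
apply: (@le_trans _ _ (\sum_(k <oo)
    separated_sup C (tilted b) [set n | K_ k n !=set0] (K_ k))%E).
  apply: separated_sup_bigcup => // n x [Qx /(slab_exists _ _ _ m0)[k kP]].
  by exists k.
have z01 : 0 < z < 1.
  by rewrite expR_gt0 expR_lt1 mulNr oppr_lt0 mulr_gt0// subr_gt0.
apply: le_trans (geometric_nneseries_le _ _ (expR_ge0 _) z01).
apply: lee_nneseries => k _; first by move=> _; exact: separated_sup_ge0.
pose Tk := T + k.+1%:R * m / tau%:R; pose tk := t + k.+1%:R * m.
have TkE : Tk * tau%:R = tk by rewrite mulrDl divfK ?gt_eqF.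
have KX n : K_ k n `<=` crossing_set C psi Tk n.
  move=> x [Qx /andP[lo hi]]; split; rewrite ?TkE//.
  apply: lt_le_trans (incm n x); move: lo; rewrite /tk -natr1; lra.
apply: (@le_trans _ _ ((expR (`|b| * m - b * tk))%:E *
    invariance_pressure_at C psi varphi Tk)%E).
  apply: le_separated_sup => //; first by move=> n [x /KX Xx]; exists x.
  move=> n x [Qx /andP[lo hi]]; rewrite -expRD ler_expR itinerary_sumBZ.
  set p := itinerary_sum C psi n x in lo hi *.
  have := @ler_mul_norm _ b (tk - p) m.
  have -> : 0 <= tk - p <= m by move: lo hi; rewrite /tk -natr1; lra.
  by move=> /(_ isT); lra.
have T0Tk : T0 < Tk by rewrite ltr_wpDr// divr_ge0 ?mulr_ge0 ?(ltW m0).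
apply: le_trans (lee_wpmul2l _ (Pc _ T0Tk)) _; first by rewrite lee_fin expR_ge0.
rewrite -EFinM lee_fin TkE -expRD /a /z -expRM_natl -expRD ler_expR.
(* The exponent is [|b| * m - (b - c) * (t + k.+1 * m)]; dropping [(b - c) * (t + m)], non-negative
   as [0 <= T], makes the bound independent of [T]. *)
have : 0 <= (b - c) * (t + m) by apply: mulr_ge0; lra.
by rewrite /tk -natr1; lra.
Qed.

Lemma invariance_pressure_le (b M : R) :
  (forall n x, itinerary_sum C psi n.+1 x <= itinerary_sum C psi n x + M) ->
  (limf_esup (R_inv C psi (tilted b)) (pinfty_nbhs R) < +oo)%E ->
  (invariance_pressure C psi varphi <= b%:E)%E.
Proof.
move=> incM /lty_EFin_gt0[K K0] /limf_esup_lt_near[A [_ RK]].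
apply/lee_addgt0Pr => e e0; apply: limf_esup_le_near.
pose D := `|b| * M + ln K.
(* The three thresholds give [0 < T], the bound [K] at the shifted level [T - M / tau], and
   [D < e * (T * tau)], which absorbs the constants. *)
exists (Num.max 0 (Num.max (A + M / tau%:R) (D / (e * tau%:R)))); split.
  exact: num_real.
move=> T; rewrite !gt_max => /and3P[T0 AT DT].
have t0 : 0 < T * tau%:R by rewrite mulr_gt0.
have PT : (invariance_pressure_at C psi varphi T <=
    (expR (b * (T * tau%:R) + `|b| * M) * K)%:E)%E.
  apply: le_trans (invariance_pressure_at_le b M T incM) _.
  rewrite EFinM; apply: lee_wpmul2l; first by rewrite lee_fin expR_ge0.
  by apply: RK; rewrite ltrBrDr.
have /lne_le_ln : 0 < expR (b * (T * tau%:R) + `|b| * M) * K.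
  by rewrite mulr_gt0 ?expR_gt0.
move=> /(_ _ (separated_sup_ge0 _ _ _) PT); rewrite lnM ?posrE ?expR_gt0// expRK => lnP.
apply: le_trans (lee_wpmul2l _ lnP) _; first by rewrite lee_fin invr_ge0 ltW.
rewrite -EFinM -EFinD lee_fin mulrC ler_pdivrMr//.
move: DT; rewrite ltr_pdivrMr ?mulr_gt0// /D; lra.
Qed.

Lemma limsup_R_inv_lty (b c m : R) : 0 < m -> c < b ->
  (forall n x, itinerary_sum C psi n x + m <= itinerary_sum C psi n.+1 x) ->
  (invariance_pressure C psi varphi < c%:E)%E ->
  (limf_esup (R_inv C psi (tilted b)) (pinfty_nbhs R) < +oo)%E.
Proof.
move=> m0 cb incm /limf_esup_lt_near[A [_ Pc]].
have [|K RK] := R_inv_le b c m (Num.max 0 A) m0 cb incm.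
  move=> T; rewrite gt_max => /andP[T0 AT].
  have t0 : 0 < T * tau%:R by rewrite mulr_gt0.
  (* Multiplying by [T * tau > 0] and exponentiating turns the bound on the normalised logarithm
     into [expR (c * (T * tau))]. *)
  have := Pc T AT; rewrite lee_pdivrMl// => lnP.
  rewrite -(@lneK _ (invariance_pressure_at _ _ _ _)) ?in_itv/= ?leey ?andbT//.
    by rewrite -[leRHS]/(expeR _%:E) lee_expeR mulrC.
  exact: separated_sup_ge0.
apply: (@le_lt_trans _ _ K%:E); last exact: ltry.
apply: limf_esup_le_near; exists (Num.max 0 A); split; first exact: num_real.
by move=> T T0; apply: RK => //; move: T0; rewrite gt_max => /andP[/ltW].
Qed.

End Pressure.
End Sums.

Theorem theorem1p1 (R : realType) (X U : metricType R)
    (Sigma : control_system X U) (Q : set X)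
    (hQ : controlled_invariant Sigma Q)
    (C : invariant_partition Sigma Q) (varphi psi : U -> R)
    (hvarphi : continuous varphi) (hpsi : continuous psi)
    (hpsi0 : forall u : U, 0 < psi u) :
  invariance_pressure C psi varphi =
  ereal_inf [set beta%:E | beta in [set beta : R |
    (limf_esup (fun T : R =>
       R_inv C psi (fun u => varphi u - beta * psi u)%R T)
       (pinfty_nbhs R) < +oo)%E]].
Proof.
have [m [M [m0 inc]]] := itinerary_sum_increment C psi hpsi0.
apply/eqP; rewrite eq_le; apply/andP; split.
  apply: le_ereal_inf_tmp => _ [b Rb <-].
  by apply: (invariance_pressure_le C _ _ _ M _ Rb) => n x; case/andP: (inc n x).
(* Any [b] above some real [c] exceeding the pressure belongs to the set, so the infimum is at most
   [b]. *)
apply: le_of_lt_EFin => c b cb Pc; apply: ereal_inf_lbound; exists b => //=.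
by apply: (limsup_R_inv_lty C _ _ _ _ _ m0 cb _ Pc) => n x; case/andP: (inc n x).
Qed.
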